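(* Let $C=B^{-1}A$ and $d=B^{-1}b$. The set $Q=\{x\in\mathbf{Z}^n\mid Cx=d\}$ is nonempty. Furthermore, any vector $x\in Q$ can be maximally decomposed in terms of a new variable $z\in\mathbf{Z}^{n-m}$ as follows: $$x\in Q\iff \exists z\in\mathbf{Z}^{n-m}\text{ such that } x=\begin{bmatrix}d_1-h_1^Tz\\ d_2-h_2^Tz\\ \vdots\\ d_m-h_m^Tz\\ z_1\\ \vdots\\ z_{n-m}\end{bmatrix},$$ where $d_i$ is the $i$th component of $d=B^{-1}b$, and $h_i^T\in\mathbf{Z}^{1\times(n-m)}$ is the $i$th row of $B^{-1}[A_{m+1}\mid\cdots\mid A_n]$.
   Context: Let $1\le m<n$ be integers, $A\in\mathbf{Z}^{m\times n}$ a matrix of full row rank with columns $A_1,\ldots,A_n$, and $b\in\mathbf{Z}^m$. The submatrix $B=[A_1\mid\cdots\mid A_m]$ formed by the first $m$ columns of $A$ is unimodular, i.e. $\det B=\pm1$. ''Maximally decomposed'' is meant in the following sense: the last $n-m$ components of $x$ are completely decoupled in terms of $z$ (each is a single component of $z$), and this decomposition cannot be extended any further in general cases. *)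

(* Defs.v *)
From HB Require Import structures.
From mathcomp Require Import all_boot all_order all_algebra.
Set Implicit Arguments.
Unset Strict Implicit.
Unset Printing Implicit Defensive.
Import GRing.Theory Num.Theory.
Local Open Scope ring_scope.

(* Throughout, n = m + k: the m leading columns of A are lsubmx A, the
   k = n - m remaining ones are rsubmx A. *)

(* The rank of an integer matrix is its rank over the rationals. *)
Definition full_row_rank (m n : nat) (A : 'M[int]_(m, n)) : Prop :=
  \rank (map_mx (intr : int -> rat) A) = m.

Definition unimodular (m : nat) (B : 'M[int]_m) : Prop :=
  \det B = 1 \/ \det B = -1.

Section System.

Variables m k : nat.

Definition Bmx (A : 'M[int]_(m, m + k)) : 'M[int]_m := lsubmx A.

(* invmx is the inverse over int, which exists when Bmx A is unimodular. *)
Definition Cmx (A : 'M[int]_(m, m + k)) : 'M[int]_(m, m + k) :=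
  invmx (Bmx A) *m A.

Definition dvec (A : 'M[int]_(m, m + k)) (b : 'cV[int]_m) : 'cV[int]_m :=
  invmx (Bmx A) *m b.

Definition Q (A : 'M[int]_(m, m + k)) (b : 'cV[int]_m)
    (x : 'cV[int]_(m + k)) : Prop :=
  Cmx A *m x = dvec A b.

Definition hrow (A : 'M[int]_(m, m + k)) (i : 'I_m) : 'rV[int]_k :=
  row i (invmx (Bmx A) *m rsubmx A).

Definition decomposition (A : 'M[int]_(m, m + k)) (b : 'cV[int]_m)
    (z : 'cV[int]_k) : 'cV[int]_(m + k) :=
  col_mx (\col_i (dvec A b i 0 - (hrow A i *m z) 0 0)) z.

End System.

Section Maximality.

Variables n k : nat.

Definition parametrizes (f : 'cV[int]_k -> 'cV[int]_n)
    (P : 'cV[int]_n -> Prop) : Prop :=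
  forall x, P x <-> exists z, x = f z.

Definition decoupled (f : 'cV[int]_k -> 'cV[int]_n) (i : 'I_n) : Prop :=
  exists j : 'I_k, forall z, f z i 0 = z j 0.

(* No parametrization of P by k integers, affine or not, makes more than k
   components of x single components of z.  Distinct components of x are
   allowed to be the same component of z. *)
Definition inextensible (P : 'cV[int]_n -> Prop) : Prop :=
  forall (f : 'cV[int]_k -> 'cV[int]_n) (S : {set 'I_n}),
    parametrizes f P -> (forall i, i \in S -> decoupled f i) ->
    (#|S| <= k)%N.

Definition degenerate (P : 'cV[int]_n -> Prop) : Prop :=
  exists i j : 'I_n, i != j /\ forall x, P x -> x i 0 = x j 0.

End Maximality.

(* "Cannot be extended any further in general cases".  The qualification is
   needed: if, say, d_1 = 0 and h_1 = (-1, 0, ..., 0), then the first component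
   of x is also the single component z_1.  The general case is that in which
   the equations do not force two components of x to be equal; the last clause
   says that, whatever A is, there are right-hand sides in the general case. *)
Definition inextensible_in_general (m k : nat) (A : 'M[int]_(m, m + k)) : Prop :=
  (forall b : 'cV[int]_m, ~ degenerate (Q A b) -> inextensible k (Q A b)) /\
  (exists b : 'cV[int]_m, ~ degenerate (Q A b)).

(* Main.v *)
Require Import Defs.
From HB Require Import structures.
From mathcomp Require Import all_boot all_order all_algebra.
Set Implicit Arguments.
Unset Strict Implicit.
Unset Printing Implicit Defensive.
Import GRing.Theory Num.Theory.
Local Open Scope ring_scope.

(** A unimodular [B] is invertible over the integers, so [C = B^-1 A] is an
    integer matrix of the shape [[1 | H]].  The system [C x = d], for
    [x = (u, v)], then reads [u + H v = d]: the tail [v] is free and determines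
    the head [u = d - H v].  This is [Q_decomposition], from which
    nonemptiness and the parametrization follow.

    Maximality is a pigeonhole argument: if more than [k] components of [x]
    are single components of a parameter in [Z^k], two of them are the same
    component, hence are equal on the whole solution set, which is therefore
    degenerate ([nondegenerate_inextensible]).  Nondegenerate right-hand sides exist
    whatever [A] is ([exists_nondegenerate]): take [d = (1, ..., m)].  The
    solution with [z = 0] separates the head components from each other and
    from the tail, and the solutions with [z] a unit vector separate the tail
    components. *)

Lemma unimodular_unitmx (m : nat) (B : 'M[int]_m) :
  unimodular B -> B \in unitmx.
Proof. by case=> detB; rewrite unitmxE detB ?unitrN unitr1. Qed.

Section Solutions.

Variables (m k : nat) (A : 'M[int]_(m, m + k)).

(** The matrix [H] whose rows are the [h_i]. *)
Definition tail_coef : 'M[int]_(m, k) := invmx (Bmx A) *m rsubmx A.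

Lemma decompositionE (b : 'cV[int]_m) (z : 'cV[int]_k) :
  decomposition A b z = col_mx (dvec A b - tail_coef *m z) z.
Proof.
congr col_mx; apply/colP=> i.
rewrite [LHS]mxE [RHS]mxE [X in _ = _ + X]mxE.
by rewrite /hrow -/tail_coef -row_mul [X in _ - X]mxE.
Qed.

Hypothesis uniB : unimodular (Bmx A).

Lemma Cmx_block : Cmx A = row_mx 1%:M tail_coef.
Proof.
rewrite /Cmx -{2}[A]hsubmxK mul_mx_row mulVmx //.
exact: unimodular_unitmx.
Qed.

Lemma Q_col_mx (b u : 'cV[int]_m) (v : 'cV[int]_k) :
  Q A b (col_mx u v) <-> u = dvec A b - tail_coef *m v.
Proof.
rewrite /Q Cmx_block mul_row_col mul1mx.
by split=> [<-|->]; rewrite ?addrK ?subrK.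
Qed.

Lemma decomposition_in_Q (b : 'cV[int]_m) (z : 'cV[int]_k) :
  Q A b (decomposition A b z).
Proof. by rewrite decompositionE; apply/Q_col_mx. Qed.

Lemma Q_decomposition (b : 'cV[int]_m) (x : 'cV[int]_(m + k)) :
  Q A b x <-> exists z : 'cV[int]_k, x = decomposition A b z.
Proof.
split=> [|[z ->]]; last exact: decomposition_in_Q.
rewrite -[x]vsubmxK => /Q_col_mx ->.
by exists (dsubmx x); rewrite decompositionE.
Qed.

(** Since [b] ranges over all of [Z^m], so does [d = B^-1 b]; hence [d] can be
    chosen with components that are nonzero and pairwise distinct. *)
Lemma exists_nondegenerate : exists b : 'cV[int]_m, ~ degenerate (Q A b).
Proof.
pose d : 'cV[int]_m := \col_i i.+1%:Z.
exists (Bmx A *m d) => -[i [j [neq_ij eq_ij]]].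
have eq_dec z := eq_ij _ (decomposition_in_Q _ z).
have dE : dvec A (Bmx A *m d) = d.
  by rewrite /dvec mulKmx //; exact: unimodular_unitmx.
(* The solution with [z = 0] is [(d, 0)]: only two tail components agree. *)
have := eq_dec 0; rewrite decompositionE dE mulmx0 subr0.
move: eq_dec neq_ij; case: (split_ordP i) => i' ->;
  case: (split_ordP j) => j' -> eq_dec neq_ij; rewrite ?col_mxEu ?col_mxEd !mxE //.
  by case=> eq_i'j'; move: neq_ij; rewrite (val_inj eq_i'j') eqxx.
(* Both components are in the tail: the unit vector at [i'] separates them. *)
have := eq_dec (delta_mx i' 0); rewrite !col_mxEd !mxE !eqxx !andbT.
by move: neq_ij; rewrite eq_rshift eq_sym => /negPf ->.
Qed.

End Solutions.

(** Two decoupled components that read the same parameter agree on the whole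
    image of [f], that is on [P]; so outside the degenerate case the map sending
    a decoupled component to its parameter is injective. *)
Lemma nondegenerate_inextensible (n k : nat) (P : 'cV[int]_n -> Prop) :
  ~ degenerate P -> inextensible k P.
Proof.
move=> ndegP f S fP decS.
have /fin_all_exists[g gP] (i : {i | i \in S}) :
    exists j : 'I_k, forall z, f z (val i) 0 = z j 0.
  by apply: decS; exact: valP.
have inj_g : injective g.
  move=> i j eq_g; apply/eqP/negPn/negP => neq_ij; apply: ndegP.
  exists (val i), (val j); split=> [//|x /fP[z ->]].
  by rewrite !gP eq_g.
by have := leq_card g inj_g; rewrite card_sig card_ord.
Qed.

Theorem theorem1 (m k : nat) (hm : (1 <= m)%N) (hmn : (m < m + k)%N)
    (A : 'M[int]_(m, m + k)) (b : 'cV[int]_m)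
    (hA : full_row_rank A) (hB : unimodular (Bmx A)) :
  (exists x : 'cV[int]_(m + k), Q A b x) /\
  (forall x : 'cV[int]_(m + k),
     Q A b x <-> exists z : 'cV[int]_k, x = decomposition A b z) /\
  (forall (z : 'cV[int]_k) (j : 'I_k),
     decomposition A b z (rshift m j) 0 = z j 0) /\
  inextensible_in_general A.
Proof.
split; first by exists (decomposition A b 0); exact: decomposition_in_Q.
split; first exact: Q_decomposition.
split; first by move=> z j; rewrite /decomposition col_mxEd.
split; last exact: exists_nondegenerate.
by move=> b'; exact: nondegenerate_inextensible.
Qed.
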